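(* Let $\Omega=\{1,2,3\}^{\mathbb N}$ with the shift $\sigma$, and let $A:\Omega\to\mathbb R$ be the potential depending only on the first two coordinates given by $A(x)=-\varepsilon_{x_0x_1}$, where $\varepsilon_{11}=\varepsilon_{22}=0$ and $\varepsilon_{ij}>0$ for every other pair $(i,j)\in\{1,2,3\}^2$. Let $\mathcal P(\beta)$ be the pressure of $\beta A$. Then there exist a positive sub-exponential function $g$ and a positive real number $\rho$ such that $\mathcal P(\beta)=g(\beta)e^{-\rho\beta}$ for $\beta>0$.
   Context: $\sigma(x_0x_1x_2\ldots)=x_1x_2\ldots$. The pressure is $\mathcal P(\beta)=\sup_\mu\{h_\mu+\beta\int A\,d\mu\}$ over $\sigma$-invariant Borel probability measures $\mu$ on $\Omega$, with $h_\mu$ the Kolmogorov(-Sinai) entropy; equivalently $e^{\mathcal P(\beta)}$ is the spectral radius of the $3\times3$ matrix with entries $e^{-\beta\varepsilon_{ij}}$. Sub-exponential means $\frac1\beta\log g(\beta)\to0$ as $\beta\to+\infty$. *)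

(* Defs.v *)
From HB Require Import structures.
From mathcomp Require Import all_boot all_order all_algebra.
From mathcomp Require Import all_classical all_reals all_analysis.
Set Implicit Arguments.
Unset Strict Implicit.
Unset Printing Implicit Defensive.
Import Order.TTheory GRing.Theory Num.Theory.
Import numFieldNormedType.Exports.
Local Open Scope classical_set_scope.
Local Open Scope ring_scope.

Section entropy.
Context {R : realType} {d : measure_display} {X : measurableType d}.
Implicit Types (mu : probability X R) (T : X -> X).

Definition invariant_measure mu T : Prop :=
  forall B : set X, measurable B -> mu (T @^-1` B) = mu B.

Definition finite_measurable_partition k (P : 'I_k -> set X) : Prop :=
  [/\ forall i, measurable (P i), trivIset [set: 'I_k] P
    & \bigcup_(i in [set: 'I_k]) P i = [set: X]].

(* The atom of P \/ T^-1 P \/ ... \/ T^-(n-1) P whose itinerary is w. *)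
Definition join_atom T k (P : 'I_k -> set X) n (w : {ffun 'I_n -> 'I_k}) :
    set X :=
  [set x | forall j : 'I_n, P (w j) (iter j T x)].

(* Distinct words index disjoint atoms, and the empty ones contribute 0, as
   ln 0 = 0 in the library; hence this is the Shannon entropy of the join. *)
Definition join_entropy mu T k (P : 'I_k -> set X) (n : nat) : R :=
  - \sum_(w : {ffun 'I_n -> 'I_k})
      fine (mu (join_atom T P w)) * ln (fine (mu (join_atom T P w))).

(* The limit exists, by subadditivity, when T is measurable and mu is
   T-invariant. *)
Definition partition_entropy mu T k (P : 'I_k -> set X) : R :=
  limn (fun n => n%:R^-1 * join_entropy mu T P n).

Definition KS_entropy mu T : \bar R :=
  ereal_sup [set h | exists (k : nat) (P : 'I_k -> set X),
    finite_measurable_partition P /\ h = (partition_entropy mu T P)%:E].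

End entropy.

Definition letter : Type := discrete_topology 'I_3.
HB.instance Definition _ := DiscreteTopology.on letter.
HB.instance Definition _ := isPointed.Build letter ord0.

(* The symbols 1 and 2 of the alphabet {1, 2, 3}, which is coded as {0, 1, 2}. *)
Definition s1 : 'I_3 := @Ordinal 3 0 isT.
Definition s2 : 'I_3 := @Ordinal 3 1 isT.

Definition full_shift : Type := {ptws nat -> letter}.
HB.instance Definition _ := Pointed.on full_shift.
HB.instance Definition _ := Topological.on full_shift.

Definition Omega := g_sigma_algebraType (@open full_shift).

Definition sigma_shift (x : Omega) : Omega := fun n => x n.+1.

Section pressure.
Context {R : realType}.

Definition potential (eps : 'I_3 -> 'I_3 -> R) (x : Omega) : R :=
  - eps (x 0%N) (x 1%N).

Definition pressure (A : Omega -> R) (beta : R) : \bar R :=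
  ereal_sup [set p | exists mu : probability Omega R,
    invariant_measure mu sigma_shift /\
    p = (KS_entropy mu sigma_shift + beta%:E * \int[mu]_x (A x)%:E)%E].

Definition subexponential (g : R -> R) : Prop :=
  beta^-1 * ln (g beta) @[beta --> +oo] --> (0 : R).

End pressure.

(* Main.v *)
(** Upper bound.  For an invariant measure mu, Gibbs' inequality bounds the
    Shannon entropy of n-step itineraries by the cross entropy against any
    sub-probability.  A positive h with [Mh <= lam h], where
    [M i j = exp (- beta eps i j)], makes
    [Q i j = M i j * h j / (lam * h i)] sub-stochastic, and cross entropy
    against the chain [Q] gives [h_mu + beta * int A <= ln lam] for cylinder
    partitions; an arbitrary partition is approximated in measure by a function
    of finitely many coordinates, at a small extra cost.  An explicit h gives
    [lam = 1 + 3 exp (- rho beta) / (1 - exp (- beta eps33))].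

    Lower bound.  Choosing the cheapest among the loops 1-3-1, 2-3-2 and
    1-2-1 (with either of its two steps possibly through 3), the stationary
    Markov chain that leaves the fixed symbols with probability
    [d = exp (- rho beta)] along that loop has free energy at least
    [d (1 - d) / 2].  The chain is realised on sequences by coding the points
    of [0, 1[ through nested intervals.

    Here rho is the least of eps13 + eps31, eps23 + eps32 and
    (min (eps12, eps13 + eps32) + min (eps21, eps23 + eps31)) / 2. *)

Require Import Defs.
From HB Require Import structures.
From mathcomp Require Import all_boot all_order all_algebra.
From mathcomp Require Import all_classical all_reals all_analysis.
From mathcomp Require Import ring lra.
Import Order.TTheory GRing.Theory Num.Theory.
Import numFieldNormedType.Exports.
Local Open Scope classical_set_scope.
Local Open Scope ring_scope.

Set Implicit Arguments.
Unset Strict Implicit.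
Unset Printing Implicit Defensive.

(** * The full shift *)

Definition agree (n : nat) (x y : Omega) : Prop :=
  forall i, (i < n)%N -> x i = y i.

(** The sets containing a cylinder around [x] form a filter. It converges to [x] in each coordinate,
    the letters being discrete, hence it converges to [x] pointwise and contains every neighbourhood
    of [x]. *)
Lemma open_agree (U : set full_shift) (x : full_shift) :
  open U -> U x -> exists n, forall y, agree n x y -> U y.
Proof.
move=> oU Ux.
pose F : set_system full_shift :=
  [set A | exists n, forall y, agree n x y -> A y].
have FF : Filter F.
  split.
  - by exists 0%N.
  - move=> A B [n An] [m Bm]; exists (maxn n m) => y xy; split.
      by apply: An => i im; apply: xy; rewrite leq_max im.
    by apply: Bm => i im; apply: xy; rewrite leq_max im orbT.
  - by move=> A B AB [n An]; exists n => y /An/AB.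
have : {ptws, F --> x}.
  apply/pointwise_cvgP => t A /nbhs_singleton At.
  by exists t.+1 => y /(_ t (ltnSn t)) xy; rewrite /preimage/= -xy.
by move=> /(_ U); apply; apply: open_nbhs_nbhs; split.
Qed.

Lemma measurable_coord n (a : 'I_3) :
  measurable [set x : Omega | x n = a].
Proof.
apply: sub_sigma_algebra.
have -> : [set x : Omega | x n = a] =
  (@proj nat (fun=> letter) n) @^-1` [set a : letter] by [].
apply: open_comp; last exact: discrete_open.
by move=> x _; exact: proj_continuous.
Qed.

(** * Laws of finite-valued measurable maps *)

Section finite_valued.
Context {R : realType} {d : measure_display} {X : measurableType d}.
Variable mu : probability X R.
Implicit Types T S : finType.

Definition fin_measurable T (Y : X -> T) : Prop :=
  forall t, measurable (Y @^-1` [set t]).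

Definition pmf T (Y : X -> T) (t : T) : R := fine (mu (Y @^-1` [set t])).

Lemma fin_measurable_set T (Y : X -> T) (B : set T) :
  fin_measurable Y -> measurable (Y @^-1` B).
Proof.
move=> mY; have -> : Y @^-1` B = \bigcup_(t in B) (Y @^-1` [set t]).
  by apply/seteqP; split => [x Bx|x [t Bt /= ->]//]; exists (Y x).
by apply: fin_bigcup_measurable => // *; exact: finite_finset.
Qed.

Lemma fin_measurable_comp T S (Y : X -> T) (phi : T -> S) :
  fin_measurable Y -> fin_measurable (phi \o Y).
Proof. by move=> mY t; rewrite comp_preimage; exact: fin_measurable_set. Qed.

Lemma fin_measurable_pair T S (Y : X -> T) (Z : X -> S) :
  fin_measurable Y -> fin_measurable Z ->
  fin_measurable (fun x => (Y x, Z x)).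
Proof.
move=> mY mZ [t s].
have -> : (fun x => (Y x, Z x)) @^-1` [set (t, s)] =
    (Y @^-1` [set t]) `&` (Z @^-1` [set s]).
  by apply/seteqP; split => x /= [-> ->].
exact: measurableI.
Qed.

Lemma fin_measurable_ffun n T (Y : 'I_n -> X -> T) :
  (forall i, fin_measurable (Y i)) ->
  fin_measurable (fun x => [ffun i => Y i x]).
Proof.
move=> mY t.
have -> : (fun x => [ffun i => Y i x]) @^-1` [set t] =
    \bigcap_(i in setT) (Y i @^-1` [set t i]).
  apply/seteqP; split => [x /= <- i _ /=|x /= h]; first by rewrite ffunE.
  by apply/ffunP => i; rewrite ffunE; exact: h.
by apply: fin_bigcap_measurable => [|i _]; [exact: finite_finset|exact: mY].
Qed.

Lemma pmf_ge0 T (Y : X -> T) t : 0 <= pmf Y t.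
Proof. exact: fine_ge0. Qed.

Lemma pmfE T (Y : X -> T) t : fin_measurable Y ->
  mu (Y @^-1` [set t]) = (pmf Y t)%:E.
Proof. by move=> mY; rewrite /pmf fineK// fin_num_measure. Qed.

Lemma measure_fin_preimage T (Y : X -> T) (B : pred T) : fin_measurable Y ->
  mu (Y @^-1` [set` B]) = (\sum_(t | B t) pmf Y t)%:E.
Proof.
move=> mY; have -> : Y @^-1` [set` B] = \bigcup_(t in [set` B]) (Y @^-1` [set t]).
  by apply/seteqP; split => [x Bx|x [t Bt /= ->]//]; exists (Y x).
rewrite (@measure_fin_bigcup _ _ _ mu _ _ _ finite_finset
  (@trivIset_preimage1 _ _ _ Y))//.
rewrite -(@bigfs _ _ _ _ (index_enum T) B) ?index_enum_uniq//; last first.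
  by move=> i _; rewrite mem_index_enum.
by rewrite -sumEFin; apply: eq_bigr => t _; exact: pmfE.
Qed.

Lemma sum_pmf T (Y : X -> T) : fin_measurable Y -> \sum_t pmf Y t = 1.
Proof.
move=> mY; apply: EFin_inj; rewrite -(measure_fin_preimage predT mY).
rewrite -[RHS](@probability_setT _ _ _ mu); congr (mu _).
by apply/seteqP; split.
Qed.

Lemma pmf_marginal T S (Y : X -> T) (Z : X -> S) (phi : T -> S) (s : S) :
  fin_measurable Y -> (forall x, phi (Y x) = Z x) ->
  pmf Z s = \sum_(t | phi t == s) pmf Y t.
Proof.
move=> mY YZ; apply: EFin_inj; rewrite -measure_fin_preimage// -pmfE; last first.
  have -> : Z = phi \o Y by apply/funext => x; rewrite -YZ.
  exact: fin_measurable_comp.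
by congr (mu _); apply/seteqP; split => x /=; rewrite -YZ => /eqP.
Qed.

(** Used to collapse an expectation over long words to one over the single letter, or pair of
    letters, on which the integrand depends. *)
Lemma sum_pmf_marginal T S (Y : X -> T) (Z : X -> S) (phi : T -> S)
    (F : S -> R) :
  fin_measurable Y -> (forall x, phi (Y x) = Z x) ->
  \sum_t pmf Y t * F (phi t) = \sum_s pmf Z s * F s.
Proof.
move=> mY YZ; rewrite (partition_big phi predT)//=.
apply: eq_bigr => s _; rewrite (pmf_marginal s mY YZ) mulr_suml.
by apply: eq_bigr => t /eqP ->.
Qed.

Lemma integral_fin T (Y : X -> T) (F : T -> R) : fin_measurable Y ->
  (\int[mu]_x (F (Y x))%:E)%E = (\sum_t pmf Y t * F t)%:E.
Proof.
move=> mY.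
have FE x : (F (Y x))%:E =
    (\sum_t (F t)%:E * (\1_(Y @^-1` [set t]) x)%:E)%E :> \bar R.
  rewrite (bigD1 (Y x))//= big1 ?adde0; last first.
    by move=> t /eqP tY; rewrite indicE memNset ?mule0// => /= /esym.
  by rewrite indicE mem_set// mule1.
under eq_integral do rewrite FE.
have int1 t : mu.-integrable setT (fun x => (\1_(Y @^-1` [set t]) x)%:E).
  exact: integrable_indic.
rewrite integral_sum//; last by move=> t; exact: integrableZl.
rewrite -sumEFin; apply: eq_bigr => t _.
rewrite integralZl// integral_indic// setIT mulrC EFinM; congr (_ * _)%E.
exact: pmfE.
Qed.

Lemma pmf_iter T (Y : X -> T) (f : X -> X) j :
  measurable_fun setT f -> invariant_measure mu f -> fin_measurable Y ->
  fin_measurable (fun x => Y (iter j f x)) /\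
  pmf (fun x => Y (iter j f x)) = pmf Y.
Proof.
move=> mf inv mY; elim: j => [|j [mYj pYj]]; first by split.
have mYj' t : (fun x => Y (iter j.+1 f x)) @^-1` [set t] =
    f @^-1` ((fun x => Y (iter j f x)) @^-1` [set t]).
  by apply/seteqP; split => x; rewrite /preimage/= -iterSr.
split=> [t|].
  by rewrite mYj' -[_ @^-1` _]setTI; exact: mf.
by rewrite -pYj; apply/funext => t; rewrite /pmf mYj' inv.
Qed.

End finite_valued.

(** * Words and sets depending on finitely many coordinates *)

Lemma agree_sym n x y : agree n x y -> agree n y x.
Proof. by move=> h i /h. Qed.

Lemma agree_leq m n x y : (m <= n)%N -> agree n x y -> agree m x y.
Proof. by move=> mn h i im; apply: h; exact: leq_trans mn. Qed.

Definition word n (x : Omega) : {ffun 'I_n -> 'I_3} := [ffun i : 'I_n => x i].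

Lemma fin_measurable_word n : fin_measurable (@word n).
Proof. by apply: fin_measurable_ffun => i a; exact: measurable_coord. Qed.

Lemma word_agree n x y : word n x = word n y <-> agree n x y.
Proof.
split=> [/ffunP xy i i_n|xy]; last by apply/ffunP => i; rewrite !ffunE xy.
by have := xy (Ordinal i_n); rewrite !ffunE.
Qed.

(** These are the unions of cylinders of length [n]; stability under [agree] describes them without
    listing words. *)
Definition fdep n (B : set Omega) : Prop :=
  forall x y, agree n x y -> B x -> B y.

Lemma fdepE n B : fdep n B -> B = word n @^-1` (word n @` B).
Proof.
move=> hB; apply/seteqP; split=> [x Bx|x [y By /word_agree yx]].
  by exists x.
exact: hB yx By.
Qed.

Lemma fdep_measurable n B : fdep n B -> measurable B.
Proof.
by move=> /fdepE ->; apply: fin_measurable_set; exact: fin_measurable_word.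
Qed.

Lemma open_fdep (U : set full_shift) : open U ->
  exists V : nat -> set Omega,
    [/\ forall n, fdep n (V n), nondecreasing_seq V & U = \bigcup_n V n].
Proof.
(* The [n]-th set is the union of the cylinders of length [n] contained in [U]. *)
move=> oU; exists (fun n => [set x | forall y, agree n x y -> U y]); split.
- move=> n x y xy h z yz; apply: h => i i_n.
  by rewrite xy//; exact: yz.
- move=> m n mn; apply/subsetPset => x h y xy; apply: h.
  exact: agree_leq xy.
- apply/seteqP; split=> [x Ux|x [n _]]; last exact.
  by have [n h] := open_agree oU Ux; exists n.
Qed.

(** Open sets are countable unions of finite-coordinate sets by [open_fdep]. Measurability of maps
    into [Omega], approximation in measure and uniqueness of measures are all reduced to these
    generators. *)
Lemma measurable_fdepE :
  @measurable _ Omega = <<s [set B | exists n, fdep n B] >>.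
Proof.
apply/seteqP; split.
  apply: smallest_sub; first exact: smallest_sigma_algebra.
  move=> U /open_fdep[V [Vn _ ->]].
  by apply: sigma_algebra_bigcup => n; apply: sub_sigma_algebra; exists n.
apply: smallest_sub; first exact: sigma_algebra_measurable.
by move=> B [n /fdep_measurable].
Qed.

Lemma fdep_setI m n B C : fdep m B -> fdep n C -> fdep (maxn m n) (B `&` C).
Proof.
move=> hB hC x y xy [Bx Cx]; split.
  by apply: hB Bx; apply: agree_leq xy; rewrite leq_maxl.
by apply: hC Cx; apply: agree_leq xy; rewrite leq_maxr.
Qed.

Lemma measurable_sigma_shift : measurable_fun setT sigma_shift.
Proof.
apply: (@measurability _ _ Omega Omega _ _ _ measurable_fdepE).
move=> _ [B [n hB] <-].
rewrite setTI; apply: (@fdep_measurable n.+1) => x y xy; apply: hB => i i_n.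
by apply: xy.
Qed.

Lemma iter_sigma_shift j x i : iter j sigma_shift x i = x (j + i)%N.
Proof. by elim: j i => [|j IH] i //=; rewrite /sigma_shift IH addnS. Qed.

(** * Approximation by finitely many coordinates *)

Section approximation.
Context {R : realType}.
Variable mu : probability Omega R.

Definition symdiff (B C : set Omega) : set Omega := (B `\` C) `|` (C `\` B).

Lemma measurable_symdiff B C :
  measurable B -> measurable C -> measurable (symdiff B C).
Proof. by move=> mB mC; apply: measurableU; exact: measurableD. Qed.

Definition approximable (B : set Omega) : Prop :=
  forall e : R, 0 < e ->
    exists n C, fdep n C /\ (mu (symdiff B C) < e%:E)%E.

Lemma measure_lt_setU (A B C : set Omega) (e : R) :
  measurable A -> measurable B -> measurable C -> A `<=` B `|` C ->
  (mu B < (e / 2)%:E)%E -> (mu C < (e / 2)%:E)%E -> (mu A < e%:E)%E.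
Proof.
move=> mA mB mC ABC Be Ce.
apply: (@le_lt_trans _ _ (mu B + mu C)%E).
  apply: (@le_trans _ _ (mu (B `|` C))); last exact: measureU2.
  by apply: le_measure; rewrite ?inE//; exact: measurableU.
have -> : e = e / 2 + e / 2 by lra.
by rewrite EFinD lteD.
Qed.

Lemma measure_bigsetU_le k (F : 'I_k -> set Omega) :
  (forall i, measurable (F i)) ->
  (mu (\bigcup_i F i) <= \sum_(i < k) mu (F i))%E.
Proof.
move=> mF; have -> : \bigcup_i F i = \big[setU/set0]_(i <- index_enum 'I_k) F i.
  rewrite -bigcup_seq; apply/seteqP; split=> x [i _ Fx]; exists i => //=.
  exact: mem_index_enum.
elim: (index_enum _) => [|i s IH]; first by rewrite !big_nil measure0.
rewrite !big_cons; apply: le_trans (leeD (le_refl _) IH).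
by apply: measureU2 => //; exact: bigsetU_measurable.
Qed.

Lemma approximable_setU A B : measurable A -> measurable B ->
  approximable A -> approximable B -> approximable (A `|` B).
Proof.
move=> mA mB hA hB e e0; have e20 : 0 < e / 2 by lra.
have [m [C [hC AC]]] := hA _ e20; have [n [D [hD BD]]] := hB _ e20.
exists (maxn m n), (C `|` D); split.
  move=> x y xy [Cx|Dx]; [left; apply: hC Cx|right; apply: hD Dx].
    by apply: agree_leq xy; rewrite leq_maxl.
  by apply: agree_leq xy; rewrite leq_maxr.
have [mC mD] := (fdep_measurable hC, fdep_measurable hD).
apply: (measure_lt_setU _ _ _ _ AC BD); try exact: measurable_symdiff.
  by apply: measurable_symdiff; exact: measurableU.
move=> x [[[Ax|Bx] /not_orP[nC nD]]|[[Cx|Dx] /not_orP[nA nB]]].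
- by left; left.
- by right; left.
- by left; right.
- by right; right.
Qed.

(** By continuity from below some [G N] fills [B] up to [e / 2]; an approximation of [G N] within
    [e / 2] then serves for [B]. *)
Lemma approximable_limit (B : set Omega) (G : nat -> set Omega) :
  (forall n, measurable (G n)) -> nondecreasing_seq G -> B = \bigcup_n G n ->
  (forall n, approximable (G n)) -> approximable B.
Proof.
move=> mG ndG BG hG e e0; have e20 : 0 < e / 2 by lra.
have mB : measurable B by rewrite BG; exact: bigcupT_measurable.
have cG : mu \o G @ \oo --> mu B.
  by rewrite BG; apply: nondecreasing_cvg_mu => //; rewrite -BG.
have fB : mu B \is a fin_num by exact: fin_num_measure.
have [N GN] : exists N, (mu (B `\` G N) < (e / 2)%:E)%E.
  have cG' : fine (mu (G n)) @[n --> \oo] --> fine (mu B).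
    by apply: fine_cvg; rewrite fineK.
  have [N _ /(_ N (leqnn N))/= HN] := (proj1 (cvgrPdist_lt _ _) cG' _ e20).
  have fG : mu (G N) \is a fin_num by exact: fin_num_measure.
  have mD : mu (B `\` G N) = (mu B - mu (G N))%E.
    rewrite measureD ?ltey_eq ?fB// setIidr//.
    by rewrite BG; exact: bigcup_sup.
  exists N; rewrite mD -(fineK fB) -(fineK fG) -EFinB lte_fin.
  exact: le_lt_trans (ler_norm _) HN.
have [n [C [hC GC]]] := hG N _ e20; exists n, C; split=> //.
have mC := fdep_measurable hC.
apply: (measure_lt_setU _ _ _ _ GN GC).
- exact: measurable_symdiff.
- exact: measurableD.
- exact: measurable_symdiff.
- move=> x [[Bx nC]|[Cx nB]]; last first.
    by right; right; split => // Gx; apply: nB; rewrite BG; exists N.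
  by have [Gx|nG] := pselect (G N x); [right; left|left].
Qed.

(** The measurable approximable sets form a sigma-algebra containing the generators. Complements
    keep the symmetric difference, and a countable union is the increasing limit of its finite
    partial unions. *)
Lemma approximable_measurable B : measurable B -> approximable B.
Proof.
suff : @measurable _ Omega `<=` [set B | measurable B /\ approximable B].
  by move=> h /h[].
rewrite {1}measurable_fdepE; apply: smallest_sub; last first.
  move=> {}B [n hB]; split; first exact: fdep_measurable hB.
  move=> e e0; exists n, B; split=> //.
  by rewrite /symdiff setDv setU0 measure0 lte_fin.
split=> [|A [mA hA]|F hF].
- split=> // e e0; exists 0%N, set0; split=> //.
  by rewrite /symdiff setDv setU0 measure0 lte_fin.
- rewrite setTD; split; first exact: measurableC.
  move=> e e0; have [n [C [hC AC]]] := hA e e0; exists n, (~` C); split.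
    by move=> x y xy nCx Cy; apply: nCx; apply: hC Cy; exact: agree_sym.
  suff -> : symdiff (~` A) (~` C) = symdiff A C by [].
  by rewrite /symdiff !setDE !setCK setUC (setIC A) (setIC C).
- have mF n : measurable (F n) by have [] := hF n.
  split; first exact: bigcupT_measurable.
  apply: (@approximable_limit _ (fun n => \big[setU/set0]_(i < n.+1) F i)).
  + by move=> n; exact: bigsetU_measurable.
  + by move=> m n mn; exact/subsetPset/subset_bigsetU.
  + by rewrite -bigcup_bigsetU_bigcup.
  + move=> n; elim: n.+1 => [|{}n IH].
      rewrite big_ord0 => e e0; exists 0%N, set0; split=> //.
      by rewrite /symdiff setDv setU0 measure0 lte_fin.
    rewrite big_ord_recr/=; apply: approximable_setU => //.
      exact: bigsetU_measurable.
    by have [] := hF n.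
Qed.

(** Each level set of [c] is approximated separately, and [b] picks an index whose approximant
    contains the point. A disagreement between [b] and [c] forces the point into one of the [k]
    symmetric differences. *)
Lemma approximable_fin k (c : Omega -> 'I_k) (e : R) :
  fin_measurable c -> 0 < e ->
  exists n (b : Omega -> 'I_k),
    [/\ forall x y, agree n x y -> b x = b y, fin_measurable b &
        (mu [set x | c x != b x] < e%:E)%E].
Proof.
move=> mc e0; pose a0 := c point.
(* Sharing [e] among [k.+1] rather than [k] level sets leaves the final sum strictly below [e]. *)
have ek0 : 0 < e / k.+1%:R by rewrite divr_gt0// ltr0n.
have /choice[nC hnC] : forall i : 'I_k, exists nC : nat * set Omega,
    fdep nC.1 nC.2 /\ (mu (symdiff (c @^-1` [set i]) nC.2) < (e / k.+1%:R)%:E)%E.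
  move=> i; have [n [C hC]] := approximable_measurable (mc i) ek0.
  by exists (n, C).
pose N := \max_i (nC i).1.
pose b x := odflt a0 [pick i | `[< (nC i).2 x >] ].
have bN x y : agree N x y -> b x = b y.
  move=> xy; congr odflt; apply: eq_pick => i /=.
  apply/asboolP/asboolP; apply: (proj1 (hnC i)).
    by apply: agree_leq xy; exact: leq_bigmax.
  by apply: agree_leq (agree_sym xy); exact: leq_bigmax.
have mb : fin_measurable b.
  move=> t; apply: (@fdep_measurable N) => x y /bN xy /= bt.
  by rewrite /preimage/= -xy.
exists N, b; split=> //.
have mS i : measurable (symdiff (c @^-1` [set i]) (nC i).2).
  by apply: measurable_symdiff => //; exact: fdep_measurable (proj1 (hnC i)).
apply: (@le_lt_trans _ _
    (mu (\bigcup_i symdiff (c @^-1` [set i]) (nC i).2))).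
  apply: le_measure; rewrite ?inE.
  - have -> : [set x | c x != b x] =
      (fun x => (c x, b x)) @^-1` [set p | p.1 != p.2] by [].
    by apply: fin_measurable_set; exact: fin_measurable_pair.
  - by apply: fin_bigcup_measurable => // *; exact: finite_finset.
  - move=> x /= /eqP cb; apply: contrapT => /= nS; apply: cb.
    (* Outside all symmetric differences the only approximant containing [x] is that of [c x], so
       the choice made by [pick] is forced. *)
    have hx i : (nC i).2 x <-> c x = i.
      split=> [Cx|cx]; apply: contrapT => ncx; apply: nS; exists i => //.
        by right.
      by left.
    rewrite /b; case: pickP => [i /asboolP/hx//|/(_ (c x))/asboolP[]].
    exact/hx.
apply: (@le_lt_trans _ _
    (\sum_(i < k) mu (symdiff (c @^-1` [set i]) (nC i).2))%E).
  exact: measure_bigsetU_le.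
apply: (@le_lt_trans _ _ (\sum_(i < k) (e / k.+1%:R)%:E)%E).
  by apply: lee_sum => i _; apply/ltW; exact: (proj2 (hnC i)).
rewrite sumEFin sumr_const card_ord -[_ *+ _]mulr_natr lte_fin mulrAC.
by rewrite ltr_pdivrMr// ltr_pM2l// ltr_nat.
Qed.

End approximation.

(** * Entropy of finite distributions *)

Section finite_entropy.
Context {R : realType}.

Lemma ln_le_subr1 (x : R) : 0 < x -> ln x <= x - 1.
Proof.
by move=> x0; have := @le_ln1Dx R (x - 1); rewrite subrKC; apply; lra.
Qed.

(** Termwise [ln (q / p) <= q / p - 1], multiplied by [p]. The total mass of [q] is left free, which
    produces the last term; terms with [p t = 0] leave only [q t >= 0]. *)
Lemma gibbs_inequality (T : finType) (p q : T -> R) :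
  (forall t, 0 <= p t) -> (forall t, 0 < q t) ->
  - \sum_t p t * ln (p t) <=
  - (\sum_t p t * ln (q t)) + (\sum_t q t - \sum_t p t).
Proof.
move=> p0 q0; rewrite -subr_ge0.
have -> : - (\sum_t p t * ln (q t)) + (\sum_t q t - \sum_t p t)
    - - \sum_t p t * ln (p t) =
    \sum_t (q t - p t - p t * ln (q t) + p t * ln (p t)).
  by rewrite !big_split/= !sumrN; ring.
apply: sumr_ge0 => t _.
have [pt0|pt0] := eqVneq (p t) 0.
  by rewrite pt0 !mul0r !subr0 addr0 ltW.
have ptp : 0 < p t by rewrite lt_neqAle eq_sym pt0 p0.
have := ln_le_subr1 (divr_gt0 (q0 t) ptp); rewrite ln_div ?posrE// => h.
have := ler_wpM2l (ltW ptp) h; rewrite !mulrBr mulrCA divff// mulr1.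
by lra.
Qed.

Lemma ln_prod (I : Type) (s : seq I) (F : I -> R) : (forall i, 0 < F i) ->
  ln (\prod_(i <- s) F i) = \sum_(i <- s) ln (F i).
Proof.
move=> F0; elim: s => [|i s IH]; first by rewrite !big_nil ln1.
by rewrite !big_cons lnM ?posrE ?IH// prodr_gt0.
Qed.

(** Padding a word to a full sequence lets functions on [Omega] be evaluated on words with plain
    integer indices. *)
Definition ext n (u : {ffun 'I_n -> 'I_3}) : Omega :=
  fun i => if insub i is Some j then u j else ord0.

Lemma ext_word n x : agree n (ext (word n x)) x.
Proof. by move=> i i_n; rewrite /ext insubT ffunE. Qed.

Lemma word_ext n (u : {ffun 'I_n -> 'I_3}) : word n (ext u) = u.
Proof. by apply/ffunP => i; rewrite ffunE /ext valK. Qed.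

Definition upd (x : Omega) n (a : 'I_3) : Omega :=
  fun i => if i == n then a else x i.

Lemma sum_wordS n (F : Omega -> R) :
  (forall x y, agree n.+1 x y -> F x = F y) ->
  \sum_(u : {ffun 'I_n.+1 -> 'I_3}) F (ext u) =
  \sum_(u : {ffun 'I_n -> 'I_3}) \sum_a F (upd (ext u) n a).
Proof.
move=> hF; rewrite pair_bigA/=.
rewrite (reindex_onto (fun p : {ffun 'I_n -> 'I_3} * 'I_3 =>
    word n.+1 (upd (ext p.1) n p.2))
  (fun u => (word n (ext u), u ord_max)))/=; last first.
  move=> u _; apply/ffunP => i; rewrite ffunE /upd.
  case: eqP => [i_n|/eqP i_n]; first by congr (u _); exact/val_inj.
  have lt_in : (i < n)%N by rewrite ltn_neqAle i_n -ltnS ltn_ord.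
  by rewrite ext_word// /ext valK.
apply: eq_big => [[u a]|[u a] _] /=; last exact/hF/ext_word.
rewrite ffunE /upd eqxx; apply/eqP; congr (_, _).
apply/ffunP => i; rewrite ffunE ext_word ?ltnS 1?ltnW//.
by rewrite ltn_eqF// /ext valK.
Qed.

(** Summing out the last letter multiplies by at most 1, so induction strips all transitions; 3 is
    the number of starting letters. *)
Lemma sum_path_le (Q : 'I_3 -> 'I_3 -> R) n :
  (forall i j, 0 <= Q i j) -> (forall i, \sum_j Q i j <= 1) ->
  \sum_(u : {ffun 'I_n.+1 -> 'I_3})
     \prod_(j < n) Q (ext u j) (ext u j.+1) <= 3.
Proof.
move=> Q0 Q1; elim: n => [|n IH].
  under eq_bigr do rewrite big_ord0.
  by rewrite sumr_const card_ffun !card_ord.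
apply: le_trans IH.
rewrite (@sum_wordS n.+1 (fun x => \prod_(j < n.+1) Q (x j) (x j.+1))); last first.
  move=> x y xy; apply: eq_bigr => j _; have jn : (j < n.+1)%N := ltn_ord j.
  by rewrite (xy _ (ltnW jn)) (xy j.+1 jn).
apply: ler_sum => u _.
have -> : \sum_a \prod_(j < n.+1) Q (upd (ext u) n.+1 a j) (upd (ext u) n.+1 a j.+1)
    = \sum_a \prod_(j < n) Q (ext u j) (ext u j.+1) * Q (ext u n) a.
  apply: eq_bigr => a _; rewrite big_ord_recr/=; congr (_ * _).
    apply: eq_bigr => j _; rewrite /upd !ltn_eqF ?ltnS//.
    by rewrite ltnW// ltnS.
  by rewrite /upd ltn_eqF// eqxx.
by rewrite -mulr_sumr ler_piMr// prodr_ge0.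
Qed.

End finite_entropy.

(** * The upper bound *)

Section partition_coding.
Context {R : realType} {d : measure_display} {X : measurableType d}.

Lemma partition_coding k (P : 'I_k -> set X) :
  finite_measurable_partition P ->
  exists2 c : X -> 'I_k, fin_measurable c & forall i x, P i x <-> c x = i.
Proof.
move=> [mP tP PT].
have /choice[c hc] : forall x, exists i, P i x.
  by move=> x; have : [set: X] x by []; rewrite -PT => -[i _ Pi]; exists i.
have Pc i x : P i x <-> c x = i.
  split=> [Pi|<-//]; apply/esym; apply: (tP i (c x)) => //.
  by exists x.
exists c => // i; have -> : c @^-1` [set i] = P i => //.
by apply/seteqP; split=> x; [move/Pc|move=> /Pc].
Qed.

Definition itinerary (T : X -> X) k (c : X -> 'I_k) n (x : X) :
  {ffun 'I_n -> 'I_k} := [ffun j : 'I_n => c (iter j T x)].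

Lemma join_entropyE (mu : probability X R) (T : X -> X) k
    (P : 'I_k -> set X) (c : X -> 'I_k) n :
  (forall i x, P i x <-> c x = i) ->
  join_entropy mu T P n = - \sum_w pmf mu (itinerary T c n) w *
    ln (pmf mu (itinerary T c n) w).
Proof.
move=> Pc; congr (- _); apply: eq_bigr => w _; rewrite /pmf.
suff -> : join_atom T P w = itinerary T c n @^-1` [set w] by [].
apply/seteqP; split=> [x h|x /= <- j]; last by apply/Pc; rewrite ffunE.
by apply/ffunP => j; rewrite ffunE; apply/Pc; exact: h.
Qed.

End partition_coding.

Section upper_bound.
Context {R : realType}.
Variables (mu : probability Omega R) (eps : 'I_3 -> 'I_3 -> R).
Variables (beta lam : R) (h : 'I_3 -> R).
Hypothesis inv : invariant_measure mu sigma_shift.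
Hypothesis h0 : forall i, 0 < h i.
Hypothesis lam0 : 0 < lam.
Hypothesis sub_eigen :
  forall i, \sum_j expR (- (beta * eps i j)) * h j <= lam * h i.

Definition pair01 (x : Omega) : 'I_3 * 'I_3 := (x 0%N, x 1%N).
Let energy := \sum_p pmf mu pair01 p * eps p.1 p.2.
Let Q i j := expR (- (beta * eps i j)) * h j / (lam * h i).

Lemma fin_measurable_coord n : fin_measurable (fun x : Omega => x n : 'I_3).
Proof. by move=> a; exact: measurable_coord. Qed.

Lemma fin_measurable_pair01 : fin_measurable pair01.
Proof.
exact: (fin_measurable_pair (fin_measurable_coord _) (fin_measurable_coord _)).
Qed.

Lemma pmf_shift (T : finType) (Y : Omega -> T) j : fin_measurable Y ->
  pmf mu (fun x => Y (iter j sigma_shift x)) = pmf mu Y.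
Proof.
move=> mY.
by have [] := pmf_iter j measurable_sigma_shift inv mY.
Qed.

Let Q_gt0 i j : 0 < Q i j.
Proof. by rewrite /Q divr_gt0 ?mulr_gt0 ?expR_gt0. Qed.

Let sum_Q i : \sum_j Q i j <= 1.
Proof. by rewrite -mulr_suml ler_pdivrMr ?mulr_gt0// mul1r. Qed.

(** The terms [ln (h j) - ln (h i)] average to 0, since invariance gives both coordinates the same
    law. *)
Let sum_ln_Q : \sum_p pmf mu pair01 p * ln (Q p.1 p.2) =
  - (ln lam + beta * energy).
Proof.
have lnQ p : pmf mu pair01 p * ln (Q p.1 p.2) =
    pmf mu pair01 p * ln (h p.2) - pmf mu pair01 p * ln (h p.1)
    - ln lam * pmf mu pair01 p - beta * (pmf mu pair01 p * eps p.1 p.2).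
  rewrite /Q ln_div ?posrE ?mulr_gt0 ?expR_gt0//.
  by rewrite !lnM ?posrE ?expR_gt0// expRK; ring.
under eq_bigr do rewrite lnQ.
rewrite !big_split/= !sumrN -!mulr_sumr sum_pmf//; last exact: fin_measurable_pair01.
have -> : \sum_p pmf mu pair01 p * ln (h p.2) =
    \sum_p pmf mu pair01 p * ln (h p.1).
  rewrite (@sum_pmf_marginal _ _ _ mu _ _ pair01 (fun x => x 1%N : 'I_3) snd
    (fun a => ln (h a)) fin_measurable_pair01)//.
  rewrite (@sum_pmf_marginal _ _ _ mu _ _ pair01 (fun x => x 0%N : 'I_3) fst
    (fun a => ln (h a)) fin_measurable_pair01)//.
  apply: eq_bigr => a _; congr (_ * _).
  by have /(congr1 (@^~ a))/= := pmf_shift 1 (fin_measurable_coord 0).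
by rewrite /energy; ring.
Qed.

Section with_coding.
Variables (k : nat) (c b : Omega -> 'I_k) (m : nat) (dl : R).
Hypotheses (mc : fin_measurable c) (mb : fin_measurable b).
Hypothesis bm : forall x y, agree m x y -> b x = b y.
Hypothesis dl0 : 0 < dl.

(** For fixed [j], [r i j] is a guess for the value [i] of [c] knowing that [b] equals [j]: weight 1
    on agreement, [dl] on each error, scaled by [z] to a total of at most 1. *)
Let z := 1 + k%:R * dl.
Let r (i j : 'I_k) := (if i == j then 1 else dl) / z.
Let mis := fine (mu [set x | c x != b x]).

Let z_gt0 : 0 < z.
Proof. by rewrite /z ltr_pwDl// mulr_ge0// ltW. Qed.

Let r_gt0 i j : 0 < r i j.
Proof. by rewrite /r divr_gt0//; case: ifP. Qed.

Let sum_r j : \sum_i r i j <= 1.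
Proof.
rewrite -mulr_suml ler_pdivrMr// mul1r.
apply: (@le_trans _ _ (\sum_i ((i == j)%:R + dl))).
  by apply: ler_sum => i _; case: eqP => _; rewrite ?lerDl ?add0r// ltW.
rewrite big_split/= sumr_const card_ord -[dl *+ _]mulr_natl lerD2r.
rewrite (bigD1 j)//= eqxx big1 ?addr0// => i /negbTE -> //.
Qed.

Let sum_ln_r : \sum_p pmf mu (fun x => (c x, b x)) p * ln (r p.1 p.2) =
  - (ln z - mis * ln dl).
Proof.
have mcb := fin_measurable_pair mc mb.
have lnr p : pmf mu (fun x => (c x, b x)) p * ln (r p.1 p.2) =
    (if p.1 != p.2 then pmf mu (fun x => (c x, b x)) p else 0) * ln dl
    - ln z * pmf mu (fun x => (c x, b x)) p.
  rewrite /r; case: eqP => _ /=; rewrite ln_div ?posrE// ?ln1; ring.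
under eq_bigr do rewrite lnr.
rewrite big_split/= sumrN -mulr_sumr sum_pmf// -mulr_suml -big_mkcond/=.
have -> : \sum_(p | p.1 != p.2) pmf mu (fun x => (c x, b x)) p = mis.
  apply: EFin_inj.
  rewrite -(measure_fin_preimage mu (fun p : 'I_k * 'I_k => p.1 != p.2) mcb).
  rewrite /mis fineK// fin_num_measure//.
  exact: (fin_measurable_set [set p | p.1 != p.2] mcb).
ring.
Qed.

(** The itinerary of [c] is refined by a word long enough to determine that of [b]. The pair is
    compared by Gibbs' inequality with a weight that runs the chain [Q] along the word and then
    guesses each symbol of [c] through [r]. The weight has mass at most 3, and the final 2 is 3 -
    1. *)
Lemma entropy_itinerary_le n :
  - \sum_w pmf mu (itinerary sigma_shift c n) w *
      ln (pmf mu (itinerary sigma_shift c n) w) <=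
  (n + m)%:R * (ln lam + beta * energy) + n%:R * (ln z - mis * ln dl) + 2.
Proof.
(* At a time below [n], [b] reads [m] letters, all of index below [n + m]. The word has length
   [N.+1] so as to carry exactly [N] transitions. *)
set N := (n + m)%N.
pose Y := itinerary sigma_shift c n; pose Z x := (Y x, word N.+1 x).
have mY : fin_measurable Y.
  apply: fin_measurable_ffun => j.
  by have [] := pmf_iter j measurable_sigma_shift inv mc.
have mZ : fin_measurable Z := fin_measurable_pair mY (@fin_measurable_word N.+1).
pose q1 (u : {ffun 'I_N.+1 -> 'I_3}) :=
  \prod_(j < N) Q (ext u j) (ext u j.+1).
pose q2 (t : {ffun 'I_n -> 'I_k} * {ffun 'I_N.+1 -> 'I_3}) :=
  \prod_(j < n) r (t.1 j) (b (iter j sigma_shift (ext t.2))).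
have q1_gt0 u : 0 < q1 u by apply: prodr_gt0.
have q2_gt0 t : 0 < q2 t by apply: prodr_gt0.
(* For a fixed word, the sum over itineraries factors over times into sums of [r], each at most 1; a
   path sum for [Q] remains. *)
have sum_q : \sum_t q1 t.2 * q2 t <= 3.
  rewrite -(pair_bigA _ (fun w u => q1 u * q2 (w, u)))/= exchange_big/=.
  apply: le_trans (sum_path_le N (fun i j => ltW (Q_gt0 i j)) sum_Q).
  apply: ler_sum => u _; rewrite -mulr_sumr ler_piMr ?(ltW (q1_gt0 _))//.
  rewrite /q2/= -(bigA_distr_bigA (fun (j : 'I_n) a =>
    r a (b (iter j sigma_shift (ext u)))))/=.
  apply: prodr_ile1 => j _; rewrite sum_r andbT.
  by apply: sumr_ge0 => i _; exact/ltW.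
(* Refining cannot lower entropy: [Y] is a function of [Z], so each atom of [Z] has at most the mass
   of the atom of [Y] around it. *)
have HYZ : - \sum_w pmf mu Y w * ln (pmf mu Y w) <=
    - \sum_t pmf mu Z t * ln (pmf mu Z t).
  rewrite -(@sum_pmf_marginal _ _ _ mu _ _ Z Y fst (fun w => ln (pmf mu Y w)) mZ)//.
  rewrite lerN2; apply: ler_sum => t _.
  have [->|t0] := eqVneq (pmf mu Z t) 0; first by rewrite !mul0r.
  have Zt : 0 < pmf mu Z t by rewrite lt_neqAle eq_sym t0 pmf_ge0.
  have ZY : pmf mu Z t <= pmf mu Y t.1.
    rewrite (@pmf_marginal _ _ _ mu _ _ Z Y fst t.1 mZ)//.
    by rewrite (bigD1 t)//= lerDl sumr_ge0// => *; exact: pmf_ge0.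
  by rewrite ler_wpM2l ?pmf_ge0// ler_ln ?posrE//; exact: lt_le_trans ZY.
apply: (le_trans HYZ).
have := gibbs_inequality (fun t => pmf_ge0 mu Z t)
  (fun t => mulr_gt0 (q1_gt0 t.2) (q2_gt0 t)).
rewrite (sum_pmf mu mZ) => /le_trans; apply.
have -> : \sum_t pmf mu Z t * ln (q1 t.2 * q2 t) =
    \sum_(j < N) \sum_t pmf mu Z t * ln (Q (ext t.2 j) (ext t.2 j.+1)) +
    \sum_(j < n) \sum_t pmf mu Z t *
      ln (r (t.1 j) (b (iter j sigma_shift (ext t.2)))).
  rewrite [in RHS]exchange_big/= [X in _ = _ + X]exchange_big/= -big_split/=.
  apply: eq_bigr => t _; rewrite lnM ?posrE// !ln_prod//.
  by rewrite mulrDr !mulr_sumr.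
have -> : \sum_(j < N) \sum_t pmf mu Z t * ln (Q (ext t.2 j) (ext t.2 j.+1)) =
    N%:R * - (ln lam + beta * energy).
  rewrite -[N in RHS]card_ord mulr_natl -sumr_const; apply: eq_bigr => j _.
  have jN : (j < N)%N := ltn_ord j.
  rewrite (@sum_pmf_marginal _ _ _ mu _ _ Z
    (fun x => pair01 (iter j sigma_shift x))
    (fun t => (ext t.2 j, ext t.2 j.+1)) (fun p => ln (Q p.1 p.2)) mZ).
    by rewrite pmf_shift//; exact: fin_measurable_pair01.
  move=> x; rewrite /Z/= /pair01 !iter_sigma_shift addn0 addn1.
  by rewrite !ext_word// ltnW.
have -> : \sum_(j < n) \sum_t pmf mu Z t *
      ln (r (t.1 j) (b (iter j sigma_shift (ext t.2)))) =
    n%:R * - (ln z - mis * ln dl).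
  rewrite -[n in RHS]card_ord mulr_natl -sumr_const; apply: eq_bigr => j _.
  have jn : (j < n)%N := ltn_ord j.
  pose cb x := (c x, b x).
  rewrite (@sum_pmf_marginal _ _ _ mu _ _ Z
    (fun x => cb (iter j sigma_shift x))
    (fun t => (t.1 j, b (iter j sigma_shift (ext t.2))))
    (fun p => ln (r p.1 p.2)) mZ).
    by rewrite pmf_shift//; exact: fin_measurable_pair.
  move=> x; rewrite /Z/= ffunE /cb; congr (_, _); apply: bm => i im.
  rewrite !iter_sigma_shift ext_word// ltnS /N.
  by rewrite leq_add// ltnW.
by lra.
Qed.

End with_coding.
End upper_bound.

(** * Free energy of an arbitrary invariant measure *)

Section pressure_upper_bound.
Context {R : realType}.
Variables (mu : probability Omega R) (eps : 'I_3 -> 'I_3 -> R).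
Variables (beta lam : R) (h : 'I_3 -> R).
Hypothesis inv : invariant_measure mu sigma_shift.
Hypothesis h0 : forall i, 0 < h i.
Hypothesis lam1 : 1 <= lam.
Hypothesis beta0 : 0 <= beta.
Hypothesis eps0 : forall i j, 0 <= eps i j.
Hypothesis sub_eigen :
  forall i, \sum_j expR (- (beta * eps i j)) * h j <= lam * h i.

Let energy := \sum_p pmf mu pair01 p * eps p.1 p.2.
Let E := ln lam + beta * energy.

(** The error [e] is spent in three parts, in this order: [dl] makes [ln z <= e / 3], then the
    mismatch [e'] makes [- p * ln dl <= e / 3], then a large [n] absorbs the boundary term
    [m * E + 2]. *)
Lemma partition_entropy_le k (P : 'I_k -> set Omega) :
  finite_measurable_partition P -> partition_entropy mu sigma_shift P <= E.
Proof.
have lam0 : 0 < lam by exact: lt_le_trans lam1.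
have E0 : 0 <= E.
  rewrite /E addr_ge0 ?ln_ge0// mulr_ge0// sumr_ge0// => p _.
  by rewrite mulr_ge0// pmf_ge0.
move=> /partition_coding[c mc Pc].
(* [limn] of a divergent sequence is 0, so no subadditivity is needed. *)
have [cv|dv] :=
  pselect (cvgn (fun n => n%:R^-1 * join_entropy mu sigma_shift P n));
  last by rewrite /partition_entropy (dvgP dv).
apply/ler_addgt0Pl => e e0.
pose dl := e / 3 / k.+1%:R; have dl0 : 0 < dl by rewrite !divr_gt0.
pose e' := e / 3 / (1 + `|ln dl|).
have ldl0 : 0 < 1 + `|ln dl| by rewrite ltr_pwDl.
have e'0 : 0 < e' by rewrite divr_gt0// divr_gt0.
have [m [b [bm mb mis]]] := approximable_fin mu mc e'0.
set z := 1 + k%:R * dl; set p := fine (mu [set x | c x != b x]).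
have mS : measurable [set x | c x != b x].
  exact: (fin_measurable_set [set p | p.1 != p.2] (fin_measurable_pair mc mb)).
have pe : p <= e'.
  by rewrite -lee_fin /p fineK ?fin_num_measure//; exact: ltW.
have p0 : 0 <= p by exact: fine_ge0.
have small : ln z - p * ln dl <= e / 3 + e / 3.
  apply: lerD.
    have zd0 : 0 <= k%:R * dl by rewrite mulr_ge0// ltW.
    apply: (@le_trans _ _ (k%:R * dl)); first by apply: le_ln1Dx; lra.
    rewrite /dl mulrCA ler_piMr//; first by rewrite divr_ge0// ltW.
    by rewrite ler_pdivrMr// mul1r ler_nat.
  apply: (@le_trans _ _ (p * (1 + `|ln dl|))).
    rewrite -mulrN ler_wpM2l//.
    by apply: le_trans (ler_norm _) _; rewrite normrN lerDr.
  by rewrite -ler_pdivlMr.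
rewrite /partition_entropy; apply: limr_le => //.
near=> n.
have n0 : 0 < n%:R :> R by rewrite ltr0n; near: n; exact: nbhs_infty_gt.
rewrite mulrC ler_pdivrMr// (join_entropyE _ _ _ Pc).
apply: (le_trans (entropy_itinerary_le inv h0 lam0 sub_eigen mc mb bm dl0 n)).
have : m%:R * E + 2 <= e / 3 * n%:R.
  rewrite -ler_pdivrMl ?divr_gt0//.
  by near: n; exact: nbhs_infty_ger.
have := ler_wpM2l (ltW n0) small.
rewrite -/z -/p -/energy -/E natrD => h1 h2.
have -> : (e + E) * n%:R = n%:R * E + n%:R * (e / 3 + e / 3) + e / 3 * n%:R.
  by field.
by rewrite mulrDl; lra.
Unshelve. all: by end_near. Qed.

Lemma integral_potential :
  (\int[mu]_x (potential eps x)%:E)%E = (- energy)%:E.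
Proof.
have -> : (fun x => (potential eps x)%:E) =
    fun x => ((fun p : 'I_3 * 'I_3 => - eps p.1 p.2) (pair01 x))%:E :> \bar R.
  by [].
rewrite (integral_fin mu (fun p => - eps p.1 p.2) fin_measurable_pair01).
by congr EFin; rewrite /energy -sumrN; apply: eq_bigr => p _; rewrite mulrN.
Qed.

Lemma free_energy_le :
  (KS_entropy mu sigma_shift + beta%:E * \int[mu]_x (potential eps x)%:E
    <= (ln lam)%:E)%E.
Proof.
rewrite integral_potential -EFinM mulrN EFinN leeBlDr// -EFinD.
apply: ge_ereal_sup => _ [k [P [hP ->]]]; rewrite lee_fin.
exact: partition_entropy_le.
Qed.

End pressure_upper_bound.

(** * Measures with given cylinder probabilities *)

Definition s3 : 'I_3 := @Ordinal 3 2 isT.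

Lemma letterP (i : 'I_3) : [\/ i = s1, i = s2 | i = s3].
Proof.
case: i => -[|[|[|//]]] lt_i3; [apply: Or31|apply: Or32|apply: Or33];
  exact: val_inj.
Qed.

Lemma sum_letter (R : realType) (F : 'I_3 -> R) :
  \sum_i F i = F s1 + F s2 + F s3.
Proof.
rewrite !big_ord_recl big_ord0 addr0 addrA.
by congr (F _ + F _ + F _); exact: val_inj.
Qed.

(** With the last letter first, extending a word is a [cons], which fits the recursions for
    intervals and Markov weights. *)
Fixpoint rprefix (x : Omega) n : seq 'I_3 :=
  if n is n'.+1 then (x n' : 'I_3) :: rprefix x n' else [::].

Lemma size_rprefix x n : size (rprefix x n) = n.
Proof. by elim: n => //= n ->. Qed.

Lemma rprefix_agree x y n : rprefix x n = rprefix y n <-> agree n x y.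
Proof.
elim: n => [|n IH] /=; first by split.
split=> [[xyn /IH xy] i|xy].
  by rewrite ltnS leq_eqVlt => /predU1P[->//|]; exact: xy.
by rewrite xy//; congr (_ :: _); apply/IH => i i_n; apply: xy; exact: ltnW.
Qed.

Section word_measure.
Context {R : realType}.
(* Words are read backwards, the last letter first. *)
Variable p : seq 'I_3 -> R.
Hypothesis p_nil : p [::] = 1.
Hypothesis p_ge0 : forall w, 0 <= p w.
Hypothesis p_cons : forall w, \sum_i p (i :: w) = p w.

Let off w (i : 'I_3) : R :=
  if i == s1 then 0 else if i == s2 then p (s1 :: w)
  else p (s1 :: w) + p (s2 :: w).

(* The word w owns the interval [left_end w, left_end w + p w[, which is cut
   into the intervals of its three extensions. *)
Fixpoint left_end w : R :=
  if w is i :: w' then left_end w' + off w' i else 0.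

Let digit w (t : R) : 'I_3 :=
  if t < left_end w + p (s1 :: w) then s1
  else if t < left_end w + (p (s1 :: w) + p (s2 :: w)) then s2 else s3.

Fixpoint digits n (t : R) : seq 'I_3 :=
  if n is n'.+1 then digit (digits n' t) t :: digits n' t else [::].

(** The values outside [0, 1[ are immaterial: Lebesgue measure is restricted to [0, 1[ before being
    pushed forward. *)
Definition code (t : R) : Omega := fun n => digit (digits n t) t.

Lemma rprefix_code n t : rprefix (code t) n = digits n t.
Proof. by elim: n => //= n ->. Qed.

(** Induction on the word: the empty word owns [0, 1[ by [p_nil], and by [p_cons] the half-open
    intervals of the three extensions tile that of [w]. A word of weight 0 owns an empty
    interval. *)
Lemma digits_itv w (t : R) : (0 <= t < 1 /\ digits (size w) t = w) <->
  left_end w <= t < left_end w + p w.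
Proof.
elim: w => [|i w IH] /=.
  by rewrite p_nil add0r; split=> [[]|].
have := p_cons w; rewrite sum_letter => pw.
have := (p_ge0 (s1 :: w), p_ge0 (s2 :: w), p_ge0 (s3 :: w)) => -[[p1 p2] p3].
have -> : (0 <= t < 1 /\ digit (digits (size w) t) t :: digits (size w) t = i :: w)
   <-> (left_end w <= t < left_end w + p w /\ digit w t = i).
  split=> [[t01 [di dw]]|[/IH[t01 dw] di]].
    by rewrite dw in di; split=> //; apply/IH.
  by rewrite dw di.
set a := left_end w + p (s1 :: w).
set b := left_end w + (p (s1 :: w) + p (s2 :: w)).
have ea : a = left_end w + p (s1 :: w) by [].
have eb : b = left_end w + (p (s1 :: w) + p (s2 :: w)) by [].
rewrite /digit /off -/a -/b; case: (letterP i) => -> /=; split=> [[/andP[h3 h4]]|].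
1, 3, 5: by case: (ltP t a) => h1; [|case: (ltP t b) => h2]; try by [];
  move=> _; apply/andP; split; lra.
all: move=> /andP[h3 h4]; split; first by apply/andP; split; lra.
all: by case: (ltP t a) => h1; [|case: (ltP t b) => h2]; first [by []|exfalso; lra].
Qed.

Lemma measurable_digits w : measurable [set t : R | digits (size w) t = w].
Proof.
elim: w => [|i w IH] /=.
  have -> : [set t : R | [::] = [::] :> seq 'I_3] = setT by apply/seteqP.
  exact: measurableT.
have -> : [set t | digit (digits (size w) t) t :: digits (size w) t = i :: w] =
    [set t : R | digits (size w) t = w] `&` [set t | digit w t = i].
  apply/seteqP; split=> [t [di dw]|t /= [dw di]]; last by rewrite dw di.
  by rewrite dw in di.
apply: measurableI => //.
have mlt (a : R) : measurable [set t : R | t < a].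
  have -> : [set t : R | t < a] = `]-oo, a[%classic.
    by apply/seteqP; split=> t /=; rewrite in_itv.
  exact: measurable_itv.
rewrite /digit; set a := _ + _; set b := left_end w + _.
case: (letterP i) => ->.
- have -> : [set t | (if t < a then s1 else if t < b then s2 else s3) = s1] =
      [set t : R | t < a].
    by apply/seteqP; split=> t /=; do 2?case: ifP.
  exact: mlt.
- have -> : [set t | (if t < a then s1 else if t < b then s2 else s3) = s2] =
      ~` [set t : R | t < a] `&` [set t : R | t < b].
    by apply/seteqP; split=> t /=; case: (t < a) => //; case: (t < b) => // -[].
  by apply: measurableI => //; exact: measurableC.
- have -> : [set t | (if t < a then s1 else if t < b then s2 else s3) = s3] =
      ~` [set t : R | t < a] `&` ~` [set t : R | t < b].
    by apply/seteqP; split=> t /=; case: (t < a) => //; case: (t < b) => // -[].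
  by apply: measurableI => //; exact: measurableC.
Qed.

Lemma measurable_code : measurable_fun setT (code : measurableTypeR R -> Omega).
Proof.
apply: (@measurability _ _ _ Omega _ _ _ measurable_fdepE).
move=> _ [B [n /fdepE ->] <-]; rewrite setTI.
rewrite -comp_preimage; apply: fin_measurable_set => u.
have -> : (word n \o code) @^-1` [set u] =
    [set t | digits (size (rprefix (ext u) n)) t = rprefix (ext u) n].
  apply/seteqP; split=> t /=; rewrite size_rprefix -rprefix_code.
    by move=> <-; apply/rprefix_agree/agree_sym/ext_word.
  by move=> /rprefix_agree/word_agree ->; rewrite word_ext.
exact: measurable_digits.
Qed.

(** The measure is the image of Lebesgue measure on [0, 1[ under [code]; the preimage of the
    cylinder of [w] is an interval of length [p w]. *)
Lemma word_measure_exists : exists mu : probability Omega R,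
  forall x n, mu [set y | agree n x y] = (p (rprefix x n))%:E.
Proof.
have m01 : measurable (`[0, 1[%classic : set R) by exact: measurable_itv.
pose m0 := mrestr (@lebesgue_measure R) m01.
pose m := pushforward m0 code : set Omega -> \bar R.
have mE x n : m [set y | agree n x y] = (p (rprefix x n))%:E.
  rewrite /m /pushforward /m0 /mrestr.
  set w := rprefix x n.
  have -> : code @^-1` [set y | agree n x y] `&` `[0, 1[%classic =
      `[left_end w, left_end w + p w[%classic.
    apply/seteqP; split=> t /=; rewrite !in_itv/=.
      move=> [/agree_sym/rprefix_agree xt t01]; apply/digits_itv; split=> //.
      by rewrite size_rprefix -rprefix_code.
    move=> /digits_itv[t01]; rewrite size_rprefix -rprefix_code => xt.
    by split=> //; apply/agree_sym/rprefix_agree.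
  rewrite lebesgue_measure_itv/= lte_fin ltrDl -EFinD addrC addKr.
  (* An empty interval has measure 0, and then [p w] vanishes by nonnegativity. *)
  by case: ltP => // pw; congr EFin; apply/le_anti; rewrite pw p_ge0.
have mT : m setT = 1%E.
  have := mE point 0%N; rewrite /= p_nil => <-; congr (m _).
  by apply/seteqP; split.
pose mm : {measure set Omega -> \bar R} :=
  @measure_function_pushforward__canonical__measure_function_Measure _ _
    (measurableTypeR R) Omega R (mrestr (@lebesgue_measure R) m01) code
    measurable_code.
have mmT : mm setT = 1%E by [].
pose mu : probability Omega R := HB.pack (Measure.sort mm)
  (Measure_isProbability.Build _ _ _ (Measure.sort mm) mmT).
by exists mu.
Qed.

End word_measure.

(** * Markov measures *)

Definition scons (a : 'I_3) (x : Omega) : Omega :=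
  fun n => if n is n'.+1 then x n' else a.

Section markov.
Context {R : realType}.
Variables (pi : 'I_3 -> R) (M : 'I_3 -> 'I_3 -> R).
Hypothesis pi_ge0 : forall i, 0 <= pi i.
Hypothesis M_ge0 : forall i j, 0 <= M i j.
Hypothesis sum_pi : \sum_i pi i = 1.
Hypothesis sum_M : forall i, \sum_j M i j = 1.
Hypothesis stationary : forall j, \sum_i pi i * M i j = pi j.

Fixpoint markov_word (w : seq 'I_3) : R :=
  if w is i :: w' then
    if w' is j :: _ then markov_word w' * M j i else pi i
  else 1.

Lemma markov_word_ge0 w : 0 <= markov_word w.
Proof.
elim: w => [|i [|j w] IH]//=.
by rewrite mulr_ge0.
Qed.

Lemma markov_word_cons w : \sum_i markov_word (i :: w) = markov_word w.
Proof. by case: w => [|j w]//; rewrite -mulr_sumr sum_M mulr1. Qed.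

Lemma markov_rprefix x n : markov_word (rprefix x n.+1) =
  pi (x 0%N) * \prod_(j < n) M (x j) (x j.+1).
Proof.
elim: n => [|n IH]; first by rewrite big_ord0 mulr1.
by rewrite big_ord_recr/= mulrA -IH.
Qed.

(** Stationarity settles length 1; further transitions at the end of the word do not involve the
    prepended letter and factor out. *)
Lemma markov_scons x n :
  \sum_a markov_word (rprefix (scons a x) n.+1) = markov_word (rprefix x n).
Proof.
case: n => [|n]; first by [].
elim: n => [|n IH]; first by rewrite /= stationary.
have -> : markov_word (rprefix x n.+2) =
  markov_word (rprefix x n.+1) * M (x n) (x n.+1) by [].
by rewrite -IH mulr_suml.
Qed.

Variable mu : probability Omega R.
Hypothesis mu_agree : forall x n,
  mu [set y | agree n x y] = (markov_word (rprefix x n))%:E.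

Lemma pmf_word n (u : {ffun 'I_n -> 'I_3}) :
  pmf mu (word n) u = markov_word (rprefix (ext u) n).
Proof.
rewrite /pmf; have -> : word n @^-1` [set u] = [set y | agree n (ext u) y].
  apply/seteqP; split=> y /=; first by move=> <-; exact: ext_word.
  by move=> /word_agree <-; rewrite word_ext.
by rewrite mu_agree.
Qed.

(** The image of [mu] under the shift and [mu] itself agree on finite-coordinate sets, which are
    stable under intersection and generate. On a cylinder this is [markov_scons], the shift preimage
    being split by its first letter. *)
Lemma markov_invariant : invariant_measure mu sigma_shift.
Proof.
pose mu' : {measure set Omega -> \bar R} :=
  @measure_function_pushforward__canonical__measure_function_Measure _ _
    Omega Omega R mu sigma_shift measurable_sigma_shift.
suff mu'E B : measurable B -> mu' B = mu B by move=> B /mu'E.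
apply: (measure_unique [set B | exists n, fdep n B] (fun=> setT)).
- exact: measurable_fdepE.
- by move=> A C [m hA] [n hC]; exists (maxn m n); exact: fdep_setI.
- by move=> _; exists 0%N.
- by apply/seteqP; split=> // x _; exists 0%N.
- move=> {}B [n hB].
  have mn : fin_measurable (word n \o sigma_shift).
    move=> t; rewrite -[_ @^-1` _]setTI.
    exact: (measurable_sigma_shift measurableT (fin_measurable_word t)).
  have BE : B = word n @^-1` [set` [pred u | `[< B (ext u) >] ]].
    apply/seteqP; split=> x /=.
      by move=> Bx; apply/asboolP; apply: hB Bx; exact/agree_sym/ext_word.
    by move=> /asboolP; apply: hB; exact: ext_word.
  have mw := @fin_measurable_word n.
  have muB := measure_fin_preimage mu [pred u | `[< B (ext u) >] ] mw.
  have muS := measure_fin_preimage mu [pred u | `[< B (ext u) >] ] mn.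
  rewrite -BE in muB; rewrite comp_preimage -BE in muS.
  apply: etrans muS _; apply: etrans (esym muB).
  congr EFin; apply: eq_bigr => u _; rewrite pmf_word -markov_scons.
  pose Y (y : Omega) := (y 0%N : 'I_3, word n (sigma_shift y)).
  have mY : fin_measurable Y.
    by apply: fin_measurable_pair => // a; exact: measurable_coord.
  rewrite (@pmf_marginal _ _ _ mu _ _ Y _ snd u mY)//.
  rewrite (reindex_onto (fun a => (a, u)) fst)/=; last first.
    by move=> [a v] /= /eqP ->.
  apply: eq_big => [a|a _]; first by rewrite !eqxx.
  rewrite /pmf; have -> : Y @^-1` [set (a, u)] =
      [set y | agree n.+1 (scons a (ext u)) y].
    apply/seteqP; split=> y /=.
      by move=> [<- <-] [|i]//=; rewrite ltnS => /ext_word.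
    move=> h; congr (_, _); first by rewrite -(h 0%N).
    rewrite -[RHS]word_ext; apply/word_agree => i i_n.
    by rewrite /sigma_shift -(h i.+1).
  by rewrite mu_agree.
- by move=> _; rewrite /mu'/= /pushforward preimage_setT probability_setT ltry.
Qed.

Lemma pmf_pair01 i : pmf mu pair01 i = pi i.1 * M i.1 i.2.
Proof.
rewrite /pmf; have -> : pair01 @^-1` [set i] =
    [set y | agree 2 (scons i.1 (scons i.2 point)) y].
  apply/seteqP; split=> y /=; first by move=> <- [|[|]].
  by move=> h; rewrite /pair01 -(h 0%N)// -(h 1%N)//=; case: i {h}.
by rewrite mu_agree.
Qed.

Let coord_part (i : 'I_3) : set Omega := [set x | x 0%N = i].

Lemma coord_partition : finite_measurable_partition coord_part.
Proof.
split=> [i||]; first exact: measurable_coord.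
- by move=> i j _ _ [x [/= xi xj]]; rewrite -xi -xj.
- by apply/seteqP; split=> // x _; exists (x 0%N).
Qed.

Let start_ent := \sum_i pmf mu (fun x : Omega => x 0%N : 'I_3) i * ln (pi i).
Let step_ent := \sum_p pmf mu pair01 p * ln (M p.1 p.2).

(** The logarithm of a word's weight splits into one starting term and [n] transition terms, all
    transitions having the same law by invariance. Words of weight 0 contribute 0 on both sides, and
    the others have only positive factors. *)
Lemma markov_join_entropy n : join_entropy mu sigma_shift coord_part n.+1 =
  - (start_ent + n%:R * step_ent).
Proof.
pose c (x : Omega) : 'I_3 := x 0%N.
rewrite (@join_entropyE _ _ _ _ _ _ _ c)//.
have -> : itinerary sigma_shift c n.+1 = word n.+1.
  by apply/funext => x; apply/ffunP => j; rewrite !ffunE /c iter_sigma_shift addn0.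
congr (- _).
have mW := @fin_measurable_word n.+1.
have lnE u : pmf mu (word n.+1) u * ln (pmf mu (word n.+1) u) =
    pmf mu (word n.+1) u * ln (pi (ext u 0%N)) + \sum_(j < n)
      pmf mu (word n.+1) u * ln (M (ext u j) (ext u j.+1)).
  rewrite -mulr_sumr -mulrDr.
  have [->|u0] := eqVneq (pmf mu (word n.+1) u) 0; first by rewrite !mul0r.
  congr (_ * _); move: u0; rewrite pmf_word markov_rprefix.
  rewrite mulf_eq0 negb_or prodf_seq_neq0 => /andP[p0 /allP m0].
  have mj (j : 'I_n) : 0 < M (ext u j) (ext u j.+1).
    by rewrite lt_neqAle eq_sym M_ge0 andbT; apply: m0; rewrite mem_index_enum.
  rewrite lnM ?posrE ?prodr_gt0//; last by rewrite lt_neqAle eq_sym p0 pi_ge0.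
  by rewrite ln_prod.
under eq_bigr do rewrite lnE.
rewrite big_split/= exchange_big/=; congr (_ + _).
  apply: (@sum_pmf_marginal _ _ _ mu _ _ (word n.+1) (fun x => x 0%N : 'I_3)
    (fun u => ext u 0%N) (fun a => ln (pi a)) mW) => x.
  exact: ext_word.
rewrite -[n in RHS]card_ord mulr_natl -sumr_const; apply: eq_bigr => j _.
have jn : (j < n)%N := ltn_ord j.
rewrite (@sum_pmf_marginal _ _ _ mu _ _ (word n.+1)
  (fun x => pair01 (iter j sigma_shift x))
  (fun u => (ext u j, ext u j.+1)) (fun p => ln (M p.1 p.2)) mW).
  by rewrite pmf_shift//; [exact: markov_invariant|exact: fin_measurable_pair01].
move=> x; rewrite /pair01 !iter_sigma_shift addn0 addn1.
by rewrite !ext_word// ltnW.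
Qed.

Lemma markov_partition_entropy :
  partition_entropy mu sigma_shift coord_part = - step_ent.
Proof.
(* Shifting the index by one makes the sequence the constant [- step_ent] plus a multiple of
   [1 / (n + 1)]. *)
apply/cvg_lim => //; rewrite -cvg_shiftS/=.
have -> : (fun n => n.+1%:R^-1 * join_entropy mu sigma_shift coord_part n.+1) =
    (fun n => - step_ent + (step_ent - start_ent) * harmonic n).
  apply/funext => n; rewrite markov_join_entropy /harmonic/=.
  by rewrite -natr1; field; rewrite natr1 pnatr_eq0.
have : - step_ent + (step_ent - start_ent) * harmonic n @[n --> \oo] -->
    - step_ent + (step_ent - start_ent) * 0.
  by apply: cvgD; [exact: cvg_cst|apply: cvgMl_tmp; exact: cvg_harmonic].
by rewrite mulr0 addr0.
Qed.

(** The entropy is a supremum over partitions, so it is at least the entropy rate found for the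
    first-coordinate partition. *)
Lemma markov_pressure_ge (eps : 'I_3 -> 'I_3 -> R) (beta : R) :
  ((\sum_i \sum_j pi i * M i j * (- ln (M i j) - beta * eps i j))%:E <=
   pressure (potential eps) beta)%E.
Proof.
apply: (@le_trans _ _ (KS_entropy mu sigma_shift +
    beta%:E * \int[mu]_x (potential eps x)%:E)%E); last first.
  by apply: ereal_sup_ubound; exists mu; split => //; exact: markov_invariant.
rewrite integral_potential.
have -> : \sum_i \sum_j pi i * M i j * (- ln (M i j) - beta * eps i j) =
    - step_ent + beta * - \sum_p pmf mu pair01 p * eps p.1 p.2.
  rewrite pair_bigA/= mulrN mulr_sumr -!sumrN -big_split/=.
  by apply: eq_bigr => p _; rewrite pmf_pair01; ring.
rewrite EFinD EFinM; apply: leeD => //.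
apply: ereal_sup_ubound; exists 3%N, coord_part; split.
  exact: coord_partition.
by rewrite markov_partition_entropy.
Qed.

End markov.

Lemma pressure_ge_markov (R : realType) (pi : 'I_3 -> R)
    (M eps : 'I_3 -> 'I_3 -> R) (beta : R) :
  (forall i, 0 <= pi i) -> (forall i j, 0 <= M i j) ->
  \sum_i pi i = 1 -> (forall i, \sum_j M i j = 1) ->
  (forall j, \sum_i pi i * M i j = pi j) ->
  ((\sum_i \sum_j pi i * M i j * (- ln (M i j) - beta * eps i j))%:E <=
   pressure (potential eps) beta)%E.
Proof.
move=> pi0 M0 pi1 M1 st.
have [mu hmu] := word_measure_exists erefl
  (markov_word_ge0 pi0 M0) (markov_word_cons pi1 M1).
exact: (markov_pressure_ge pi0 M0 pi1 st hmu).
Qed.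

(** * Bounds for the pressure *)

Definition vec3 (T : Type) (a b c : T) (i : 'I_3) : T :=
  if i == s1 then a else if i == s2 then b else c.

Section bounds.
Context {R : realType}.
Variables (eps : 'I_3 -> 'I_3 -> R).
Hypothesis eps11 : eps s1 s1 = 0.
Hypothesis eps22 : eps s2 s2 = 0.
Hypothesis eps_gt0 : forall i j : 'I_3,
  (i, j) <> (s1, s1) -> (i, j) <> (s2, s2) -> 0 < eps i j.

Definition cost12 : R := Num.min (eps s1 s2) (eps s1 s3 + eps s3 s2).
Definition cost21 : R := Num.min (eps s2 s1) (eps s2 s3 + eps s3 s1).

(** The cost is counted per departure from a fixed symbol: a round trip between 1 and 2 contains two
    departures, hence the division by 2. *)
Definition exponent : R :=
  Num.min (Num.min (eps s1 s3 + eps s3 s1) (eps s2 s3 + eps s3 s2))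
    ((cost12 + cost21) / 2).

Lemma exponent_gt0 : 0 < exponent.
Proof.
rewrite /exponent /cost12 /cost21.
have h i j : (i != j) || (i == s3) -> 0 < eps i j.
  move=> ij; apply: eps_gt0 => -[ei ej]; move: ij; by rewrite ei ej.
have [e12 e13 e21] := And3 (h s1 s2 isT) (h s1 s3 isT) (h s2 s1 isT).
have [e23 e31 e32] := And3 (h s2 s3 isT) (h s3 s1 isT) (h s3 s2 isT).
by rewrite !lt_min; apply/andP; split; [|apply: divr_gt0 => //;
  apply: addr_gt0; rewrite lt_min]; apply/andP; split; lra.
Qed.

(* Going through 3 in both steps of 1-2-1 costs the average of the loops 1-3-1
   and 2-3-2, hence never beats the cheaper of them. *)
Lemma exponentP : [\/ exponent = eps s1 s3 + eps s3 s1,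
  exponent = eps s2 s3 + eps s3 s2 |
  [\/ exponent = (eps s1 s2 + eps s2 s1) / 2,
      exponent = (eps s1 s3 + eps s3 s2 + eps s2 s1) / 2 |
      exponent = (eps s1 s2 + eps s2 s3 + eps s3 s1) / 2]].
Proof.
rewrite /exponent /cost12 /cost21.
case: (leP (eps s1 s3 + eps s3 s1) (eps s2 s3 + eps s3 s2)) => h1;
case: leP => h2.
- by apply: Or31.
- move: h2; case: (leP (eps s1 s2)) => h3; case: (leP (eps s2 s1)) => h4 h2.
  + by apply: Or33; apply: Or31.
  + by apply: Or33; apply: Or33; rewrite addrA.
  + by apply: Or33; apply: Or32.
  + by exfalso; lra.
- by apply: Or32.
- move: h2; case: (leP (eps s1 s2)) => h3; case: (leP (eps s2 s1)) => h4 h2.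
  + by apply: Or33; apply: Or31.
  + by apply: Or33; apply: Or33; rewrite addrA.
  + by apply: Or33; apply: Or32.
  + by exfalso; lra.
Qed.

Variable beta : R.
Hypothesis beta0 : 0 < beta.
Let dl := expR (- (exponent * beta)).

Let dl_gt0 : 0 < dl. Proof. exact: expR_gt0. Qed.

Let dl_lt1 : dl < 1.
Proof. by rewrite /dl expR_lt1 oppr_lt0 mulr_gt0 ?exponent_gt0. Qed.

Let dl_ln : dl <= - ln (1 - dl).
Proof. by have := @ln_le_subr1 _ (1 - dl); have := dl_lt1; lra. Qed.

Let ln_dl : ln dl = - (exponent * beta). Proof. by rewrite expRK. Qed.

(** In each chain below a departure has probability [dl], and its gain [- ln dl = exponent * beta]
    offsets the cost of the loop on average. Only the terms for staying at a fixed symbol survive,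
    and [c] is the stationary mass of the fixed symbols visited. *)
Let pressure_ge_chain (pi : 'I_3 -> R) (M : 'I_3 -> 'I_3 -> R) (c : R) :
  (forall i, 0 <= pi i) -> (forall i j, 0 <= M i j) ->
  \sum_i pi i = 1 -> (forall i, \sum_j M i j = 1) ->
  (forall j, \sum_i pi i * M i j = pi j) ->
  1 / 2 <= c ->
  \sum_i \sum_j pi i * M i j * (- ln (M i j) - beta * eps i j) =
    c * ((1 - dl) * (- ln (1 - dl))) ->
  ((dl * (1 - dl) / 2)%:E <= pressure (potential eps) beta)%E.
Proof.
move=> pi0 M0 pi1 M1 st c2 V.
apply: le_trans (pressure_ge_markov eps beta pi0 M0 pi1 M1 st).
rewrite V lee_fin [leLHS]mulrC; apply: ler_pM; rewrite ?invr_ge0//.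
- by rewrite mulr_ge0 ?subr_ge0 ?(ltW dl_gt0) ?(ltW dl_lt1).
- by rewrite -div1r.
- by rewrite mulrC ler_wpM2l// subr_ge0 ltW.
Qed.

Lemma pressure_lower :
  ((dl * (1 - dl) / 2)%:E <= pressure (potential eps) beta)%E.
Proof.
have [d0 d1] := (dl_gt0, dl_lt1).
have simp := (@sum_letter R, @ln1 R, ln_dl, eps11, eps22).
have d1n : 1 + dl != 0 by rewrite gt_eqF//; lra.
have d2n : 2 + dl != 0 by rewrite gt_eqF//; lra.
have inv1 : 0 <= (1 + dl)^-1 by rewrite invr_ge0; lra.
have inv2 : 0 <= (2 + dl)^-1 by rewrite invr_ge0; lra.
have div1 : 0 <= dl / (1 + dl) by rewrite divr_ge0//; lra.
have div2 : 0 <= dl / (2 + dl) by rewrite divr_ge0//; lra.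
have half1 : 1 / 2 <= (1 + dl)^-1.
  by rewrite -[leRHS]div1r ler_pdivlMr; lra.
have half2 : 1 / 2 <= 2 / (2 + dl) by rewrite ler_pdivlMr; lra.
case: exponentP => [h|h|[h|h|h]].
(* Loop 1-3-1: each departure from 1 spends one step at 3, so 3 has [dl] times the mass of 1. *)
- apply: (pressure_ge_chain (pi := vec3 (1 + dl)^-1 0 (dl / (1 + dl)))
    (M := vec3 (vec3 (1 - dl) 0 dl) (vec3 1 0 0) (vec3 1 0 0)) (c := (1 + dl)^-1)).
  + by move=> i; rewrite /vec3; do ?case: ifP.
  + by move=> i j; rewrite /vec3; do ?case: ifP => _; lra.
  + by rewrite simp /vec3/=; field.
  + by move=> i; rewrite simp; case: (letterP i) => ->; rewrite /vec3/=; ring.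
  + by move=> i; rewrite simp; case: (letterP i) => ->; rewrite /vec3/=; field.
  + by [].
  + by rewrite !simp /vec3/= h; field.
- apply: (pressure_ge_chain (pi := vec3 0 (1 + dl)^-1 (dl / (1 + dl)))
    (M := vec3 (vec3 0 1 0) (vec3 0 (1 - dl) dl) (vec3 0 1 0)) (c := (1 + dl)^-1)).
  + by move=> i; rewrite /vec3; do ?case: ifP.
  + by move=> i j; rewrite /vec3; do ?case: ifP => _; lra.
  + by rewrite simp /vec3/=; field.
  + by move=> i; rewrite simp; case: (letterP i) => ->; rewrite /vec3/=; ring.
  + by move=> i; rewrite simp; case: (letterP i) => ->; rewrite /vec3/=; field.
  + by [].
  + by rewrite !simp /vec3/= h; field.
(* Direct loop 1-2-1: a symmetric chain on the two fixed symbols. *)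
- apply: (pressure_ge_chain (pi := vec3 (1 / 2) (1 / 2) 0)
    (M := vec3 (vec3 (1 - dl) dl 0) (vec3 dl (1 - dl) 0) (vec3 1 0 0)) (c := 1)).
  + by move=> i; rewrite /vec3; do ?case: ifP => _; lra.
  + by move=> i j; rewrite /vec3; do ?case: ifP => _; lra.
  + by rewrite simp /vec3/=; field.
  + by move=> i; rewrite simp; case: (letterP i) => ->; rewrite /vec3/=; ring.
  + by move=> i; rewrite simp; case: (letterP i) => ->; rewrite /vec3/=; field.
  + by lra.
  + by rewrite !simp /vec3/= h; field.
(* Loop 1-3-2-1. *)
- apply: (pressure_ge_chain
    (pi := vec3 (2 + dl)^-1 (2 + dl)^-1 (dl / (2 + dl)))
    (M := vec3 (vec3 (1 - dl) 0 dl) (vec3 dl (1 - dl) 0) (vec3 0 1 0))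
    (c := 2 / (2 + dl))).
  + by move=> i; rewrite /vec3; do ?case: ifP.
  + by move=> i j; rewrite /vec3; do ?case: ifP => _; lra.
  + by rewrite simp /vec3/=; field.
  + by move=> i; rewrite simp; case: (letterP i) => ->; rewrite /vec3/=; ring.
  + by move=> i; rewrite simp; case: (letterP i) => ->; rewrite /vec3/=; field.
  + by [].
  + by rewrite !simp /vec3/= h; field.
(* Loop 1-2-3-1. *)
- apply: (pressure_ge_chain
    (pi := vec3 (2 + dl)^-1 (2 + dl)^-1 (dl / (2 + dl)))
    (M := vec3 (vec3 (1 - dl) dl 0) (vec3 0 (1 - dl) dl) (vec3 1 0 0))
    (c := 2 / (2 + dl))).
  + by move=> i; rewrite /vec3; do ?case: ifP.
  + by move=> i j; rewrite /vec3; do ?case: ifP => _; lra.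
  + by rewrite simp /vec3/=; field.
  + by move=> i; rewrite simp; case: (letterP i) => ->; rewrite /vec3/=; ring.
  + by move=> i; rewrite simp; case: (letterP i) => ->; rewrite /vec3/=; field.
  + by [].
  + by rewrite !simp /vec3/= h; field.
Qed.

Let m33 := expR (- (beta * eps s3 s3)).
(** The sum of the geometric series of powers of [m33], that is, the total weight of all possible
    stays at 3. *)
Let K := (1 - m33)^-1.

Lemma pressure_upper :
  (pressure (potential eps) beta <= (3 * K * dl)%:E)%E.
Proof.
have d0 := dl_gt0; pose lam := 1 + 3 * K * dl.
have m331 : m33 < 1.
  by rewrite /m33 expR_lt1 oppr_lt0 mulr_gt0// eps_gt0.
have m330 : 0 < m33 by exact: expR_gt0.
have K1 : 1 <= K by rewrite /K -[leRHS]div1r ler_pdivlMr; lra.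
have KE : K - m33 * K = 1.
  by rewrite -{1}(mul1r K) -mulrBl mulfV// gt_eqF//; lra.
have Kd : dl <= K * dl by rewrite ler_peMl// ltW.
have [e13 e23 e12] : [/\ exponent <= eps s1 s3 + eps s3 s1,
    exponent <= eps s2 s3 + eps s3 s2 & 2 * exponent <= cost12 + cost21].
  have : exponent <= exponent by [].
  by rewrite {2}/exponent !le_min => /andP[/andP[-> ->]] ?; split=> //; lra.
have [c12 c132] : cost12 <= eps s1 s2 /\ cost12 <= eps s1 s3 + eps s3 s2.
  by have : cost12 <= cost12 by []; rewrite {2}/cost12 le_min => /andP.
have [c21 c231] : cost21 <= eps s2 s1 /\ cost21 <= eps s2 s3 + eps s3 s1.
  by have : cost21 <= cost21 by []; rewrite {2}/cost21 le_min => /andP.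
(* [t] balances the two directions: [cost12 - exponent] is the largest exponent keeping every
   passage from 1 to 2 below [dl], and [2 * exponent <= cost12 + cost21] then handles the passages
   back. *)
pose t := expR (beta * (cost12 - exponent)).
pose m i j := expR (- (beta * eps i j)).
have t0 : 0 < t by exact: expR_gt0.
have m0 i j : 0 < m i j by exact: expR_gt0.
pose s := m s3 s1 + m s3 s2 * t.
have s0 : 0 < s by rewrite addr_gt0 ?mulr_gt0.
(* The entry at 3 solves the third row with eigenvalue 1: it weighs the exits [s] from 3 by all
   stays at 3. *)
pose h := vec3 1 t (K * s).
have le_exp (a b : R) : a <= b -> expR (beta * a) <= expR (beta * b).
  by move=> ab; rewrite ler_expR ler_wpM2l// ltW.
have mE i j : m i j = expR (beta * - eps i j) by rewrite mulrN.
have dE : dl = expR (beta * - exponent) by rewrite mulrN mulrC.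
have b12 : m s1 s2 * t <= dl.
  by rewrite mE dE -expRD -mulrDr; apply: le_exp; lra.
have b131 : m s1 s3 * m s3 s1 <= dl.
  by rewrite !mE dE -expRD -mulrDr; apply: le_exp; lra.
have b132 : m s1 s3 * m s3 s2 * t <= dl.
  by rewrite !mE dE -!expRD -!mulrDr; apply: le_exp; lra.
have b21 : m s2 s1 <= dl * t.
  by rewrite mE dE -expRD -mulrDr; apply: le_exp; lra.
have b231 : m s2 s3 * m s3 s1 <= dl * t.
  by rewrite !mE dE -!expRD -!mulrDr; apply: le_exp; lra.
have b232 : m s2 s3 * m s3 s2 <= dl.
  by rewrite !mE dE -!expRD -!mulrDr; apply: le_exp; lra.
have K0 : 0 <= K by lra.
have m11 : m s1 s1 = 1 by rewrite /m eps11 mulr0 oppr0 expR0.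
have m22 : m s2 s2 = 1 by rewrite /m eps22 mulr0 oppr0 expR0.
apply: ge_ereal_sup => _ [mu [inv ->]].
apply: (@le_trans _ _ (ln lam)%:E); last first.
  by rewrite lee_fin /lam; apply: le_ln1Dx; lra.
apply: (@free_energy_le _ _ _ _ _ h) => //.
- by move=> i; rewrite /h /vec3; do ?case: ifP => _ //; rewrite mulr_gt0//; lra.
- by rewrite /lam; lra.
- exact: ltW.
- move=> i j; have [[-> ->]|/eqP n1] := eqVneq (i, j) (s1, s1).
    by rewrite eps11.
  have [[-> ->]|/eqP n2] := eqVneq (i, j) (s2, s2); first by rewrite eps22.
  exact/ltW/eps_gt0.
- move=> i; rewrite sum_letter -/(m i s1) -/(m i s2) -/(m i s3).
  case: (letterP i) => ->; rewrite /h /vec3/= /lam.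
  (* Besides staying, row 1 has three passages: directly to 2, and through 3 to 1 or to 2. Each
     weighs at most [K * dl], whence the factor 3 in [lam]; row 2 is similar, scaled by [t]. *)
  + have := ler_wpM2l K0 b131; have := ler_wpM2l K0 b132.
    rewrite m11 /s; set x := K * (_ * t); set y := K * (_ * _).
    have -> : m s1 s3 * (K * (m s3 s1 + m s3 s2 * t)) = y + x.
      by rewrite /x /y; ring.
    by lra.
  + have := ler_wpM2l K0 b231.
    have := ler_wpM2l K0 (ler_wpM2r (ltW t0) b232).
    have := ler_wpM2r (ltW t0) Kd.
    rewrite m22 /s; set x := K * (_ * t); set y := K * (_ * m s3 s1).
    have -> : m s2 s3 * (K * (m s3 s1 + m s3 s2 * t)) = y + x.
      by rewrite /x /y; ring.
    rewrite -[(K * dl) * t]mulrA.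
    have -> : (1 + 3 * K * dl) * t = t + 3 * (K * (dl * t)) by ring.
    by lra.
  (* Row 3 holds with equality for eigenvalue 1, by [K = 1 + m33 * K], and [lam >= 1]. *)
  + have -> : m s3 s1 * 1 + m s3 s2 * t + m s3 s3 * (K * s) = K * s.
      rewrite mulr1 -/s -[X in X + _](mul1r s) -KE /m33 -/(m s3 s3); ring.
    rewrite ler_peMl ?mulr_ge0// ?(ltW s0)//.
    by rewrite lerDl !mulr_ge0// ltW.
Qed.

End bounds.

(** * The sub-exponential prefactor *)

Theorem proposition7p1 (R : realType) (eps : 'I_3 -> 'I_3 -> R)
  (eps11 : eps s1 s1 = 0) (eps22 : eps s2 s2 = 0)
  (eps_gt0 : forall i j : 'I_3,
    (i, j) <> (s1, s1) -> (i, j) <> (s2, s2) -> 0 < eps i j) :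
  exists (g : R -> R) (rho : R),
    [/\ forall beta : R, 0 < beta -> 0 < g beta,
        subexponential g,
        0 < rho
      & forall beta : R, 0 < beta ->
          pressure (potential eps) beta
            = (g beta * expR (- (rho * beta)))%:E].
Proof.
have rho0 := exponent_gt0 eps_gt0.
set rho := exponent eps in rho0 *.
pose dl (beta : R) := expR (- (rho * beta)).
pose K (beta : R) := (1 - expR (- (beta * eps s3 s3)))^-1.
pose p (beta : R) := fine (pressure (potential eps) beta).
have low beta (b0 : 0 < beta) := pressure_lower eps11 eps22 eps_gt0 b0.
have upp beta (b0 : 0 < beta) := pressure_upper eps11 eps22 eps_gt0 b0.
have pE beta : 0 < beta -> pressure (potential eps) beta = (p beta)%:E.
  move=> b0; rewrite /p fineK// fin_numE; apply/andP; split.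
    by apply/eqP => e; have := low _ b0; rewrite e leeNy_eq.
  by apply/eqP => e; have := upp _ b0; rewrite e leye_eq.
have plow beta : 0 < beta -> dl beta * (1 - dl beta) / 2 <= p beta.
  by move=> b0; rewrite -lee_fin -pE//; exact: low.
have pupp beta : 0 < beta -> p beta <= 3 * K beta * dl beta.
  by move=> b0; rewrite -lee_fin -pE//; exact: upp.
have dl0 beta : 0 < dl beta by exact: expR_gt0.
have dl1 beta : 0 < beta -> dl beta < 1.
  by move=> b0; rewrite expR_lt1 oppr_lt0 mulr_gt0.
have p0 beta : 0 < beta -> 0 < p beta.
  move=> b0; apply: lt_le_trans (plow _ b0).
  by rewrite divr_gt0// mulr_gt0// subr_gt0 dl1.
have expdl beta : expR (rho * beta) * dl beta = 1.
  by rewrite /dl expRN mulfV// gt_eqF// expR_gt0.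
(* The formula holds by the choice of [g]; the content is that [g] stays between two positive
   constants for large [beta]. *)
exists (fun beta => p beta * expR (rho * beta)), rho; split=> //.
- by move=> beta b0; rewrite mulr_gt0 ?p0 ?expR_gt0.
- have e330 : 0 < eps s3 s3 by apply: eps_gt0.
  have half (x : R) : 1 <= x -> expR (- x) <= 1 / 2.
    move=> x1; rewrite expRN -div1r ler_pdivrMr ?expR_gt0//.
    by have := expR_ge1Dx x; lra.
  apply/cvgrPdist_le => e e0.
  near=> beta.
  have b0 : 0 < beta by near: beta; exact: nbhs_pinfty_gt.
  have d2 : dl beta <= 1 / 2.
    by apply: half; rewrite -ler_pdivrMl// mulr1.
  have m2 : expR (- (beta * eps s3 s3)) <= 1 / 2.
    by apply: half; rewrite -ler_pdivrMr.
  have K2 : K beta <= 2 by rewrite /K -[leLHS]div1r ler_pdivrMr; lra.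
  set g := p beta * _.
  (* The upper bound for the pressure gives [g <= 3 * K], with [K <= 2]. *)
  have g6 : g <= 6.
    have := ler_wpM2r (ltW (expR_gt0 (rho * beta))) (pupp _ b0).
    have -> : 3 * K beta * dl beta * expR (rho * beta) =
      3 * K beta * (expR (rho * beta) * dl beta) by ring.
    by rewrite -/g expdl; lra.
  (* The lower bound gives [g >= (1 - dl) / 2], with [dl <= 1 / 2]. *)
  have g4 : 1 / 4 <= g.
    have := ler_wpM2r (ltW (expR_gt0 (rho * beta))) (plow _ b0).
    have -> : dl beta * (1 - dl beta) / 2 * expR (rho * beta) =
      (1 - dl beta) / 2 * (expR (rho * beta) * dl beta) by ring.
    by rewrite -/g expdl; lra.
  have g0 : 0 < g by lra.
  (* The inequality [ln x <= x - 1] at [g] and at its inverse gives [ln g <= 5] and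
     [- ln g <= 3]. *)
  have lng : `|ln g| <= 6.
    rewrite ler_norml; apply/andP; split; last first.
      by have := ln_le_subr1 g0; lra.
    have gi0 : 0 < g^-1 by rewrite invr_gt0.
    have gi : g^-1 <= 4 by rewrite -div1r ler_pdivrMr; lra.
    by have := ln_le_subr1 gi0; rewrite lnV ?posrE//; lra.
  rewrite sub0r normrN normrM normfV (gtr0_norm b0) ler_pdivrMl//.
  apply: (le_trans lng); by rewrite -ler_pdivrMr.
- move=> beta b0; rewrite pE// -mulrA; congr EFin.
  by rewrite -/(dl beta) expdl mulr1.
Unshelve. all: by end_near. Qed.
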